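(* Let $n,k,m$ be positive integers and suppose $\mathcal{F}$ is either $\mathrm{Inj}_m(n,k)$ or $\mathrm{Sur}_1(n,k)$. Then the size of any $\mathbf{w}$-orbit of $\mathcal{F}$ is a multiple of $\frac{k}{\gcd(n,k)}$.
   Context: Notation: $[n]=\{1,\dots,n\}$. $\mathrm{Inj}_m(n,k)$ is the set of functions $f:[n]\to[k]$ with $\#f^{-1}(t)\le m$ for every $t\in[k]$. $\mathrm{Sur}_1(n,k)$ is the set of surjections $[n]\to[k]$. Whirling: for a family $\mathcal{F}$ of functions $[n]\to[k]$ and $i\in[n]$, the map $w_i:\mathcal{F}\to\mathcal{F}$ sends $f\in\mathcal{F}$ to the function obtained by repeatedly adding $1$ modulo $k$ to the value of $f$ at $i$ (residues represented in $[k]$, all other values unchanged, at least one addition performed), stopping the first time the resulting function is in $\mathcal{F}$. Each $w_i$ is a bijection of $\mathcal{F}$. The whirling map is $\mathbf{w}=w_n\circ\cdots\circ w_2\circ w_1$ (so $w_1$ is applied first). *)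

(* Defs.v *)
From mathcomp Require Import all_boot.

Set Implicit Arguments.
Unset Strict Implicit.
Unset Printing Implicit Defensive.

(* The index sets [n] and [k] are rendered as 'I_n and 'I_k, i.e. shifted to   *)
(* start at 0. The shift j |-> j - 1 commutes with adding 1 modulo k, which is *)
(* ordS on 'I_k.                                                               *)

Definition Inj (m n k : nat) : {set {ffun 'I_n -> 'I_k}} :=
  [set f : {ffun 'I_n -> 'I_k} | [forall t, #|f @^-1: [set t]| <= m]].

Definition Sur1 (n k : nat) : {set {ffun 'I_n -> 'I_k}} :=
  [set f : {ffun 'I_n -> 'I_k} | [forall t, exists i, f i == t]].

Section Whirling.

Variables (n k : nat).
Implicit Types (F : {set {ffun 'I_n -> 'I_k}}) (f g : {ffun 'I_n -> 'I_k}).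

Definition incr_at (i : 'I_n) f : {ffun 'I_n -> 'I_k} :=
  [ffun j => if j == i then ordS (f j) else f j].

(* The number of additions performed by w_i: the least t >= 1 such that the    *)
(* t-th iterate is in F. Searching 1 <= t <= k is enough for f in F, since     *)
(* k additions give f back (whirlP); the value for f outside F is irrelevant.  *)
Definition whirl_time F (i : 'I_n) f : nat :=
  (find (fun t => iter t.+1 (incr_at i) f \in F) (iota 0 k)).+1.

Definition whirl F (i : 'I_n) f : {ffun 'I_n -> 'I_k} :=
  iter (whirl_time F i f) (incr_at i) f.

(* enum 'I_n is increasing, so the whirl at the smallest index acts first.     *)
Definition whirling F f : {ffun 'I_n -> 'I_k} :=
  foldl (fun g i => whirl F i g) f (enum 'I_n).

Lemma iter_incr_at i f t j :
  iter t (incr_at i) f j = iter (if j == i then t else 0) (@ordS k) (f j).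
Proof.
elim: t => [|t IHt] /=; first by case: (j == i).
by rewrite ffunE IHt; case: (j == i).
Qed.

Lemma incr_at_inj i : injective (incr_at i).
Proof.
move=> f g /ffunP eq_fg; apply/ffunP => j; have:= eq_fg j.
by rewrite !ffunE; case: ifP => // _ /ordS_inj.
Qed.

Lemma iter_incr_at_k i f : iter k (incr_at i) f = f.
Proof.
apply/ffunP => j; rewrite iter_incr_at; case: eqP => //= _.
have val_iter t (x : 'I_k) : iter t (@ordS k) x = (x + t) %% k :> nat.
  elim: t => [|t IHt] /=; first by rewrite addn0 modn_small.
  by rewrite IHt -[in LHS]addn1 modnDml addn1 addnS.
by apply: val_inj; rewrite /= val_iter modnDr modn_small.
Qed.

Lemma whirlP F i f : f \in F ->
  [/\ 0 < whirl_time F i f <= k, whirl F i f \in F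
    & forall s, 0 < s < whirl_time F i f -> iter s (incr_at i) f \notin F].
Proof.
move=> Ff; have k_gt0 : 0 < k by case: (k) (f i) => [[]|].
have hasF : has (fun t => iter t.+1 (incr_at i) f \in F) (iota 0 k).
  apply/hasP; exists k.-1; first by rewrite mem_iota /= add0n prednK.
  by rewrite prednK // iter_incr_at_k.
have lt_k := hasF; rewrite has_find size_iota in lt_k.
split=> //; first by have := nth_find 0 hasF; rewrite nth_iota.
case=> // s /= lt_s; have /= := before_find 0 lt_s.
by rewrite nth_iota ?(ltn_trans _ lt_k) // add0n => ->.
Qed.

Lemma whirling_in F f : f \in F -> whirling F f \in F.
Proof.
rewrite /whirling; elim: (enum _) f => //= i s IHs f Ff.
by apply: IHs; case: (whirlP i Ff).
Qed.

Lemma whirl_inj F i : {in F &, injective (whirl F i)}.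
Proof.
move=> f g; wlog le_fg : f g / whirl_time F i f <= whirl_time F i g.
  move=> W Ff Fg e; case/orP: (leq_total (whirl_time F i f) (whirl_time F i g)).
    by move=> le; apply: W.
  by move=> le; apply/esym/W.
move=> Ff Fg; rewrite /whirl -(subnKC le_fg) iterD.
have inj_iter t : injective (iter t (incr_at i)).
  by elim: t => [|t IHt] x y //= /incr_at_inj/IHt.
move/inj_iter => def_f.
have [_ _ minF] := whirlP i Fg; have [/andP[t_gt0 _] _ _] := whirlP i Ff.
move: def_f; case: (posnP (whirl_time F i g - whirl_time F i f)) => [-> // | d_gt0] def_f.
have lt_d : 0 < whirl_time F i g - whirl_time F i f < whirl_time F i g.
  by rewrite d_gt0 ltn_subrL t_gt0 (leq_trans t_gt0).
by have := minF _ lt_d; rewrite -def_f Ff.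
Qed.

(* Hence whirling F permutes the finite set F, and on F the forward orbits     *)
(* of fingraph are its orbits as a permutation.                                *)
Lemma whirling_inj F : {in F &, injective (whirling F)}.
Proof.
rewrite /whirling; elim: (enum _) => //= i s IHs f g Ff Fg.
have [_ Fwf _] := whirlP i Ff; have [_ Fwg _] := whirlP i Fg.
by move/(IHs _ _ Fwf Fwg)/(whirl_inj Ff Fg).
Qed.

End Whirling.

(* Main.v *)
(* Write the values put down by successive whirls as one sequence x, so that   *)
(* the window x_t, .., x_(t+n-1) lists the current function and x_(t+n) is the *)
(* new value of the entry x_t. Let a_v(T) be the number of s < T with x_s = v. *)
(* In both families a_v(T) <= a_(v+1)(T + n) + n. As x has period n * |orbit|, *)
(* this forces the counts over a period to increase weakly along v -> v + 1,   *)
(* which is cyclic, so they all agree, and k divides n * |orbit|.              *)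

Require Import Defs.
From mathcomp Require Import all_boot.
From mathcomp Require Import zify.

Set Implicit Arguments.
Unset Strict Implicit.
Unset Printing Implicit Defensive.

(** A whirl turns [v] into [v + 1] unless the family forbids it: in [Inj] when [v + 1] already fills
    [m] places, in [Sur1] when [v] would disappear. Either obstruction makes the count of [v + 1]
    lag behind that of [v] by a bounded amount only ([occ_le_Inj], [occ_le_Sur1]). Over many periods
    counts grow linearly, so a bounded lag is harmless: [dvdn_order_occ] deduces that all values are
    equally frequent in a period, and then cancels [gcdn n k]. *)

Lemma iter_ordS k t (x : 'I_k) : iter t (@ordS k) x = (x + t) %% k :> nat.
Proof.
elim: t => [|t IHt] /=; first by rewrite addn0 modn_small.
by rewrite IHt -[in LHS]addn1 modnDml addn1 addnS.
Qed.

(** A fixed point forces [k = 1]. Hence a single [v != ordS v] rules out fixed points everywhere. *)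
Lemma ordS_fixed k (u v : 'I_k) : u = ordS u -> ordS v = v.
Proof.
case: k u v => [|[|k]] u v; first by case: u.
  by rewrite (ord1 v) (ord1 (ordS ord0)).
move/(congr1 val) => /=; have := ltn_ord u.
rewrite leq_eqVlt => /predU1P[eq_u | lt_u].
  by rewrite eq_u modnn => u0; move: eq_u; rewrite u0.
by rewrite modn_small //; lia.
Qed.

(** Iterating [ordS] leads from [i] to [j] and also from [j] back to [i]. *)
Lemma homo_ordS_const k (h : 'I_k -> nat) :
  (forall j, h j <= h (ordS j)) -> forall i j, h i = h j.
Proof.
move=> h_le; suff le i j : h i <= h j by move=> i j; apply/eqP; rewrite eqn_leq !le.
have -> : j = iter (j + k - i) (@ordS k) i.
  apply: val_inj; rewrite /= iter_ordS subnKC; last first.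
    by rewrite ltnW // (leq_trans (ltn_ord i)) ?leq_addl.
  by rewrite modnDr modn_small.
by elim: (_ - _) => //= t IHt; apply: leq_trans IHt (h_le _).
Qed.

(** * The sequence of whirled values and its counts *)

Section WhirlSequence.

Variables (n k : nat) (F : {set {ffun 'I_n -> 'I_k}}) (f : {ffun 'I_n -> 'I_k}).
Hypothesis n_gt0 : 0 < n.

Definition pos t : 'I_n := Ordinal (ltn_pmod t n_gt0).

(** Time advances by one single whirl, so [n] steps from a multiple of [n] make one [whirling]. *)
Fixpoint whirl_state t : {ffun 'I_n -> 'I_k} :=
  if t is s.+1 then whirl F (pos s) (whirl_state s) else f.

Definition whirl_seq t : 'I_k := whirl_state t (pos t).

Definition occ (v : 'I_k) T : nat := \sum_(0 <= s < T) (whirl_seq s == v).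

Local Notation g := whirl_state.
Local Notation x := whirl_seq.

Lemma posDn t : pos (t + n) = pos t.
Proof. by apply: val_inj; rewrite /= modnDr. Qed.

Lemma pos_neq s t : s < t -> t < s + n -> pos t != pos s.
Proof.
move=> lt_st lt_ts; rewrite -val_eqE /= -(subnKC (ltnW lt_st)).
by rewrite -[X in _ != X %[mod n]]addn0 eqn_modDl mod0n modn_small; lia.
Qed.

Lemma pos_iota : [seq pos s | s <- iota 0 n] = enum 'I_n.
Proof.
apply: (inj_map val_inj); rewrite val_enum_ord -map_comp -[RHS]map_id.
by apply/eq_in_map => s; rewrite mem_iota /= => lt_sn; rewrite modn_small.
Qed.

Lemma pos_window j t : exists2 s, t <= s < t + n & pos s = j.
Proof.
elim: t => [|t [s /andP[le_ts lt_s] <-]].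
  by exists j; rewrite ?add0n //=; apply: val_inj; rewrite /= modn_small.
case: (ltngtP t s) le_ts => // [lt_ts | eq_ts] _; first by exists s => //; lia.
by exists (t + n); rewrite ?posDn ?eq_ts //; lia.
Qed.

Lemma whirl_state_muln q : g (q * n) = iter q (whirling F) f.
Proof.
elim: q => [|q IHq] //=; rewrite -IHq mulSn addnC /whirling -pos_iota.
have chunk r : g (q * n + r) = foldl (fun h i => whirl F i h) (g (q * n)) [seq pos s | s <- iota 0 r].
  elim: r => [|r IHr]; first by rewrite addn0.
  rewrite addnS -[in RHS]addn1 iotaD map_cat foldl_cat -IHr /= add0n.
  by congr (whirl F _ _); apply: val_inj; rewrite /= modnMDl.
exact: chunk.
Qed.

Lemma whirl_other i h j : j != i -> whirl F i h j = h j.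
Proof. by move=> ne_ji; rewrite /whirl iter_incr_at (negPf ne_ji). Qed.

Lemma whirl_state_stable s t i :
    s <= t -> (forall r, s <= r < t -> i != pos r) -> g t i = g s i.
Proof.
move=> /subnKC <-; elim: (t - s) => [|d IHd] ne_i; first by rewrite addn0.
rewrite addnS /= whirl_other ?IHd //.
  by move=> r /andP[le_sr lt_r]; apply: ne_i; lia.
by apply: ne_i; lia.
Qed.

Lemma whirl_state_window s t : t <= s < t + n -> g t (pos s) = x s.
Proof.
move=> /andP[le_ts lt_s]; apply/esym/whirl_state_stable => // r /andP[le_tr lt_rs].
by apply: pos_neq => //; lia.
Qed.

Lemma whirl_seqDn t : x (t + n) = whirl F (pos t) (g t) (pos t).
Proof.
rewrite /x posDn; apply: (@whirl_state_stable t.+1); first by lia.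
by move=> r /andP[lt_tr lt_r]; rewrite eq_sym; apply: pos_neq.
Qed.

Lemma sum_pos (w : 'I_n -> nat) t : \sum_(t <= s < t + n) w (pos s) = \sum_i w i.
Proof.
elim: t => [|t <-].
  rewrite add0n big_mkord; apply: eq_bigr => i _; congr w.
  by apply: val_inj; rewrite /= modn_small.
rewrite addSn big_nat_recr /=; last by lia.
by rewrite [RHS]big_ltn /= ?posDn 1?addnC //; lia.
Qed.

Lemma occD v t d : occ v (t + d) = occ v t + \sum_(t <= s < t + d) (x s == v).
Proof. by rewrite /occ (big_cat_nat (leq0n t)) ?leq_addr. Qed.

Lemma occS v t : occ v t.+1 = occ v t + (x t == v).
Proof. by rewrite /occ big_nat_recr. Qed.

Lemma occ_window v t : occ v (t + n) = occ v t + #|g t @^-1: [set v]|.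
Proof.
rewrite occD; congr (_ + _); rewrite -sum1_card [RHS]big_mkcond /= -(sum_pos _ t).
apply: eq_big_nat => s in_s; rewrite -(whirl_state_window in_s) !inE.
by case: eqP.
Qed.

Lemma occ_leD v t d : occ v (t + d) <= occ v t + d.
Proof.
elim: d => [|d IHd]; first by rewrite !addn0.
by rewrite addnS occS; case: eqP => _; lia.
Qed.

Lemma sum_occ T : \sum_v occ v T = T.
Proof.
elim: T => [|T IHT]; first by rewrite big1 // => v _; rewrite /occ big_nil.
under eq_bigr do rewrite occS.
rewrite big_split /= IHT (bigD1 (x T)) //= eqxx big1 ?addn1 //.
by move=> v; rewrite eq_sym; case: eqP.
Qed.

Hypothesis Ff : f \in F.

Lemma whirl_state_in t : g t \in F.
Proof. by elim: t => //= t /(whirlP (pos t))[]. Qed.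

Lemma whirl_state_period t :
  g (t + order (whirling F) f * n) = g t.
Proof.
have per : g (order (whirling F) f * n) = f.
  rewrite whirl_state_muln (@iter_order_in _ _ (mem F)) //.
  - exact: whirling_in.
  - exact: whirling_inj.
elim: t => [|t IHt]; first by rewrite add0n per.
rewrite addSn /= IHt; congr whirl.
by apply: val_inj; rewrite /= addnC modnMDl.
Qed.

Lemma occ_period v q : let L := order (whirling F) f * n in
  occ v (q * L) = q * occ v L.
Proof.
move=> L; have xL t : x (t + L) = x t.
  rewrite /x whirl_state_period; congr (g t _).
  by apply: val_inj; rewrite /= addnC modnMDl.
have shift t : occ v (t + L) = occ v t + occ v L.
  elim: t => [|t IHt]; first by rewrite /occ big_nil.
  by rewrite addSn !occS xL IHt addnAC.
elim: q => [|q IHq]; first by rewrite /occ big_nil.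
by rewrite !mulSn addnC shift IHq addnC.
Qed.

(** The constant [C] is arbitrary: it is beaten by repeating the period often enough. *)
Lemma dvdn_order_occ C :
    (forall v T, occ v T <= occ (ordS v) (T + n) + C) ->
  k %/ gcdn n k %| order (whirling F) f.
Proof.
move=> le_occ; set d := order _ _.
have k_gt0 : 0 < k by case: (k) (x 0) => [[]|].
have step v : occ v (d * n) <= occ (ordS v) (d * n).
  rewrite leqNgt; apply/negP => lt_occ.
  (* The total error is at most [C + n], the shift by [n] costing at most [n]; a loss of 1 per
     period exceeds it after [(C + n).+1] periods. *)
  have := le_occ v ((C + n).+1 * (d * n)).
  have := occ_leD (ordS v) ((C + n).+1 * (d * n)) n.
  rewrite !occ_period -/d; nia.
have eq_occ := homo_ordS_const step.
have : k %| d * n.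
  rewrite -(sum_occ (d * n)) (eq_bigr (fun=> occ (x 0) (d * n))) //.
  by rewrite sum_nat_const card_ord dvdn_mulr.
have g_gt0 : 0 < gcdn n k by rewrite gcdn_gt0 n_gt0.
have -> : (k %| d * n) = (k %/ gcdn n k %| d * (n %/ gcdn n k)).
  by rewrite -[RHS](dvdn_pmul2r g_gt0) -mulnA !divnK ?dvdn_gcdl ?dvdn_gcdr.
rewrite Gauss_dvdl // coprime_sym /coprime -(eqn_pmul2r g_gt0) muln_gcdl.
by rewrite !divnK ?dvdn_gcdl ?dvdn_gcdr // mul1n.
Qed.

End WhirlSequence.

(** * The count inequality for [Inj] *)

(* The defect a_v(t) - a_(v+1)(t + n) grows from t to t + 1 only when x_t = v  *)
(* skips v + 1, i.e. when the window at t holds m values v + 1; its value at   *)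
(* t + 1 is then at most the one at t + 1 - n, as no window has more than m    *)
(* values v.                                                                   *)
Lemma occ_le_Inj m n k (f : {ffun 'I_n -> 'I_k}) (n_gt0 : 0 < n) (Ff : f \in Inj m n k) v T :
  occ (Inj m n k) f n_gt0 v T <= occ (Inj m n k) f n_gt0 (ordS v) (T + n) + n.
Proof.
have [<-|ne] := eqVneq v (ordS v); first by rewrite occD -addnA leq_addr.
set F := Inj m n k; set o := occ F f n_gt0; set x := whirl_seq F f n_gt0.
have le_preim u t : #|whirl_state F f n_gt0 t @^-1: [set u]| <= m.
  by have := whirl_state_in n_gt0 Ff t; rewrite inE => /forallP.
elim/ltn_ind: T => -[|t] IHt; first by rewrite {1}/o /occ big_nil.
have oS u s : o u s.+1 = o u s + (x s == u) by exact: occS.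
(* For [t < n] the count is at most [t + 1 <= n], whence the additive [n]. *)
have [lt_tn | le_nt] := ltnP t n.
  have := @occ_leD _ _ F f n_gt0 v 0 t.+1.
  rewrite add0n {2}/occ big_nil -/o; lia.
have IH1 := IHt t (ltnSn t); move: IH1; rewrite addSn !oS => IH1.
have [xt | _] := eqVneq (x t) v; last by lia.
have [_ | xtn] := eqVneq (x (t + n)) (ordS v); first by lia.
set h := whirl_state F f n_gt0 t; set i := pos n_gt0 t.
have hi : h i = v by [].
have full : m <= #|h @^-1: [set ordS v]|.
  have hF : h \in F by exact: whirl_state_in.
  have [/andP[time_gt0 _] _ min_h] := whirlP i hF.
  have time_gt1 : 1 < whirl_time F i h.
    rewrite ltn_neqAle time_gt0 andbT; apply: contraNneq xtn => time1.
    by rewrite /x whirl_seqDn // /whirl -time1 /= ffunE eqxx hi.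
  have /= := min_h 1 time_gt1; rewrite inE negb_forall => /existsP[u].
  rewrite -ltnNge => lt_m.
  (* Only the fibre of [ordS v] gains an element, namely [i], so it is the one that overflows. *)
  have sub : incr_at i h @^-1: [set u] \subset
      (if u == ordS v then [set i] else set0) :|: h @^-1: [set u].
    apply/subsetP => j; rewrite !inE ffunE.
    case: (j =P i) => [->|_ ->]; last by rewrite orbT.
    by rewrite hi eq_sym => ->; rewrite inE eqxx.
  have := leq_trans lt_m (leq_trans (subset_leq_card sub) (leq_card_setU _ _)).
  case: eqP => [->|_]; first by rewrite cards1 add1n ltnS.
  by rewrite cards0 add0n => /leq_trans/(_ (le_preim u t)); rewrite ltnn.
have win : o (ordS v) (t + n) = o (ordS v) t + #|h @^-1: [set ordS v]|.
  exact: occ_window.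
have le_win := le_preim v (t.+1 - n).
have := @occ_window _ _ F f n_gt0 v (t.+1 - n).
have := IHt (t.+1 - n); rewrite subnK; last by lia.
rewrite -/o !oS xt eqxx (negPf ne) => IHn win'.
have := IHn ltac:(lia); lia.
Qed.

(** * The count inequality for [Sur1] *)

(** If [h i] is taken elsewhere, one addition keeps the map onto and the search stops at once;
    otherwise only [i] can supply [h i] to the image of the result. *)
Lemma whirl_Sur1 n k i (h : {ffun 'I_n -> 'I_k}) :
    h \in Sur1 n k -> h i != ordS (h i) ->
  whirl (Sur1 n k) i h i =
    if [exists j, (j != i) && (h j == h i)] then ordS (h i) else h i.
Proof.
move=> hF ne; have [/andP[time_gt0 _] whF min_h] := whirlP i hF.
case: existsP => [[j /andP[ne_ji /eqP eq_hj]] | no_j].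
  rewrite /whirl; suff -> : whirl_time (Sur1 n k) i h = 1 by rewrite /= ffunE eqxx.
  apply/eqP; rewrite eqn_leq time_gt0 andbT leqNgt; apply/negP => time_gt1.
  case/negP: (min_h 1 time_gt1); rewrite /= inE; apply/forallP => u.
  move: hF; rewrite inE => /forallP/(_ u)/existsP[l /eqP hl].
  have [eq_li | ne_li] := eqVneq l i; apply/existsP.
    by exists j; rewrite ffunE (negPf ne_ji) eq_hj -eq_li hl.
  by exists l; rewrite ffunE (negPf ne_li) hl.
move: whF; rewrite inE => /forallP/(_ (h i))/existsP[j /eqP wj].
have [eq_ji | ne_ji] := eqVneq j i; first by rewrite -{2}eq_ji.
by case: no_j; exists j; rewrite ne_ji -wj whirl_other /=.
Qed.

(* An entry stays put when its value is unique in the window and otherwise     *)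
(* moves up by 1. Moves from v are moves to v + 1, so it is enough to compare  *)
(* the stays at v with those at v + 1: a stay at v at time t is matched with   *)
(* the last v + 1 strictly between t and t + n, which is itself a stay.        *)
Lemma occ_le_Sur1 n k (f : {ffun 'I_n -> 'I_k}) (n_gt0 : 0 < n) (Ff : f \in Sur1 n k) v T :
  occ (Sur1 n k) f n_gt0 v T <= occ (Sur1 n k) f n_gt0 (ordS v) (T + n) + n.
Proof.
have [<-|ne] := eqVneq v (ordS v); first by rewrite occD -addnA leq_addr.
set F := Sur1 n k; set o := occ F f n_gt0; set x := whirl_seq F f n_gt0.
have ordS_neq (u : 'I_k) : u != ordS u.
  by apply: contraNneq ne => /ordS_fixed ->.
have repeat t : x (t + n) =
    if has (fun s => x s == x t) (index_iota t.+1 (t + n)) then ordS (x t) else x t.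
  rewrite {1}/x whirl_seqDn // whirl_Sur1 ?ordS_neq ?whirl_state_in //.
  congr (if _ then _ else _); apply/existsP/hasP => [[j] | [s]].
    have [s in_s <-] := pos_window n_gt0 j t; rewrite whirl_state_window // => /andP[ne_s xs].
    exists s => //; rewrite mem_index_iota; case: (ltngtP t s) in_s ne_s => //= -> _.
    by rewrite eqxx.
  rewrite mem_index_iota => /andP[lt_ts lt_s] xs; exists (pos n_gt0 s).
  by rewrite pos_neq // whirl_state_window // ltnW.
pose stay u t := (x t == u) && (x (t + n) == u).
have stay_free u t s : stay u t -> t < s < t + n -> x s != u.
  move=> /andP[/eqP xt /eqP]; rewrite repeat xt.
  case: ifP => [_ eq_u | /hasPn free _ in_s]; first by case/eqP: (ordS_neq u).
  by apply: free; rewrite mem_index_iota.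
have stay_next t : stay v t -> exists2 u, t <= u < t + n & stay (ordS v) u.
  move=> stay_t; pose P s := (t < s < t + n) && (x s == ordS v).
  have exP : exists s, P s.
    have := whirl_state_in n_gt0 Ff t; rewrite inE => /forallP/(_ (ordS v)).
    case/existsP=> j; have [s in_s <-] := pos_window n_gt0 j t.
    rewrite whirl_state_window // => xs; exists s; rewrite /P xs andbT.
    case: (ltngtP t s) in_s xs => //= <- _; case/andP: stay_t => /eqP.
    by rewrite /x => -> _; rewrite (negPf ne).
  have [|u /andP[in_u xu] max_u] := ex_maxnP exP (m := t + n).
    by move=> s /andP[/andP[_ /ltnW]].
  exists u; first by lia.
  (* Suppose another [ordS v] at [s] with [u < s < u + n]. Maximality of [u] puts [s] beyond
     [t + n]; then [s - n] lies in the window where [v] is absent, so [ordS v] stayed from [s - n]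
     to [s], although [u] lies in between. *)
  rewrite /stay xu repeat; case: ifP => [/hasP[s]|_]; last by rewrite xu.
  rewrite mem_index_iota (eqP xu) => in_s xs.
  have lt_s : t + n <= s.
    rewrite leqNgt; apply/negP => lt_s.
    by have := max_u s; rewrite /P xs andbT => /(_ ltac:(lia)); lia.
  have neq_s : s != t + n.
    by apply: contraTneq xs => ->; case/andP: stay_t => _ /eqP ->.
  pose r := s - n; have def_s : s = r + n by rewrite subnK //; lia.
  have xr : x r = ordS v.
    move: xs; rewrite def_s repeat; case: ifP => _ /eqP // /ordS_inj xr.
    by have := stay_free v t r stay_t ltac:(lia); rewrite xr eqxx.
  have stay_r : stay (ordS v) r by rewrite /stay xr -def_s xs eqxx.
  by have := stay_free _ _ u stay_r ltac:(lia); rewrite xu.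
pose stays u s := \sum_(0 <= t < s) stay u t.
have staysS u s : stays u s.+1 = stays u s + stay u s by rewrite /stays big_nat_recr.
have stays0 u : stays u 0 = 0 by rewrite /stays big_nil.
have stays_mono u s t : s <= t -> stays u s <= stays u t.
  by move=> le_st; rewrite /stays (big_cat_nat (leq0n s) le_st) leq_addr.
have stays_le s : stays v s.+1 <= stays (ordS v) (s + n).
  elim/ltn_ind: s => s IHs; rewrite staysS.
  case stay_s: (stay v s); last first.
    case: s IHs {stay_s} => [|s] IHs; rewrite addn0; first by rewrite stays0.
    by apply: leq_trans (IHs s _) _ => //; apply: stays_mono; lia.
  have [u in_u stay_u] := stay_next s stay_s.
  have gain : stays (ordS v) s + 1 <= stays (ordS v) (s + n).
    apply: leq_trans (stays_mono _ u.+1 _ _); last by lia.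
    by rewrite staysS stay_u leq_add2r stays_mono //; lia.
  (* Stays at [v] are at least [n] apart, so the induction hypothesis at [s - n] covers all the
     earlier ones. *)
  have -> : stays v s = stays v (s.+1 - n).
    rewrite /stays (@big_cat_nat _ _ _ (s.+1 - n)) //=; last by lia.
    rewrite [X in _ + X]big_nat [X in _ + X]big1 ?addn0 // => t in_t.
    case stay_t: (stay v t) => //; have := stay_free _ _ s stay_t ltac:(lia).
    by case/andP: stay_s => ->.
  apply: leq_trans gain; rewrite leq_add2r.
  have [lt_sn | le_ns] := ltnP s n.
    by rewrite (_ : s.+1 - n = 0) ?stays0 //; lia.
  by rewrite subSn //; have := IHs (s - n) ltac:(lia); rewrite subnK.
(* Without the stays, each side counts a move from [v] to [ordS v]; the stays are added crosswise to
   avoid subtraction. *)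
have balance t :
    (x t == v) + stay (ordS v) t = (x (t + n) == ordS v) + stay v t.
  have [eq_x | eq_x] : x (t + n) = x t \/ x (t + n) = ordS (x t).
  - by rewrite repeat; case: ifP => _; [right | left].
  - by rewrite /stay eq_x !andbb addnC.
  have no_stay u : stay u t = false.
    apply/negP; rewrite /stay eq_x => /andP[/eqP -> /eqP eq_u].
    by have := ordS_neq u; rewrite eq_u eqxx.
  by rewrite !no_stay eq_x (inj_eq (@ordS_inj k)).
have oS u s : o u s.+1 = o u s + (x s == u) by exact: occS.
have total : o v T + stays (ordS v) T + o (ordS v) n =
    o (ordS v) (T + n) + stays v T.
  elim: T => [|t IHt]; first by rewrite {1}/o /occ big_nil !stays0 add0n addn0.
  by rewrite addSn !oS !staysS; have := balance t; lia.
(* The delay [n] in [stays_le] costs at most [n] stays: this is the additive [n] of the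
   statement. *)
have staysD d : stays (ordS v) (T + d) <= stays (ordS v) T + d.
  elim: d => [|d IHd]; first by rewrite !addn0.
  by rewrite addnS staysS; case: (stay _ _); lia.
have := staysD n; have := stays_le T; rewrite staysS; lia.
Qed.

Theorem corollary2p21 (n k m : nat) (F : {set {ffun 'I_n -> 'I_k}})
  (n_gt0 : 0 < n) (k_gt0 : 0 < k) (m_gt0 : 0 < m)
  (hF : F = Inj m n k \/ F = Sur1 n k)
  (f : {ffun 'I_n -> 'I_k}) (Ff : f \in F) :
  k %/ gcdn n k %| order (whirling F) f.
Proof.
apply: (@dvdn_order_occ _ _ F f n_gt0 Ff n) => v T.
by case: hF Ff => -> Ff; [apply: occ_le_Inj | apply: occ_le_Sur1].
Qed.
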